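(* There exist symmetric pseudo-Boolean functions of $n$ variables for which any $y$-linear quadratization must involve at least $\Omega(n/\log n)$ auxiliary variables; that is, there is a constant $c>0$ such that for infinitely many $n$ there is a symmetric $f:\{0,1\}^n\to\mathbb{R}$ every $y$-linear quadratization of which uses at least $c\,n/\log n$ auxiliary variables.
   Context: A pseudo-Boolean function is a map $\{0,1\}^n\to\mathbb{R}$; it is symmetric if its value depends only on the Hamming weight. A quadratization of $f$ using $m$ auxiliary variables is a polynomial $g(x,y)$ of degree at most $2$ in $x_1,\ldots,x_n,y_1,\ldots,y_m$ such that $f(x)=\min\{g(x,y):y\in\{0,1\}^m\}$ for all $x\in\{0,1\}^n$. It is $y$-linear if it contains no product of two auxiliary variables, i.e. $g(x,y)=q(x)+\sum_{i=1}^m a_i(x)y_i$ with $q$ quadratic and each $a_i$ affine in $x$. *)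

(* Defs.v *)
From Stdlib Require Import Reals.
Open Scope R_scope.

(* Points of {0,1}^n are represented by x : nat -> bool; only the
   coordinates x 0, ..., x (n-1) are meaningful. *)

Definition b2R (b : bool) : R := if b then 1 else 0.

Fixpoint sumR (n : nat) (F : nat -> R) : R :=
  match n with
  | O => 0
  | S k => sumR k F + F k
  end.

Fixpoint weight (n : nat) (x : nat -> bool) : nat :=
  match n with
  | O => O
  | S k => (weight k x + (if x k then 1 else 0))%nat
  end.

(* A pseudo-Boolean function of n variables f : {0,1}^n -> R is symmetric:
   its value depends only on the Hamming weight of x.  (In particular it
   depends only on the first n coordinates.) *)
Definition symmetric (n : nat) (f : (nat -> bool) -> R) : Prop :=
  forall x x' : nat -> bool, weight n x = weight n x' -> f x = f x'.

Definition ylin_poly (n m : nat) (c : R) (b : nat -> R) (Q : nat -> nat -> R)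
  (al : nat -> R) (be : nat -> nat -> R)
  (x y : nat -> bool) : R :=
  c + sumR n (fun j => b j * b2R (x j))
    + sumR n (fun j => sumR n (fun k => Q j k * b2R (x j) * b2R (x k)))
    + sumR m (fun i => (al i + sumR n (fun j => be i j * b2R (x j))) * b2R (y i)).

Definition is_quadratization (n m : nat) (f : (nat -> bool) -> R)
  (g : (nat -> bool) -> (nat -> bool) -> R) : Prop :=
  forall x : nat -> bool,
    (exists y : nat -> bool, g x y = f x) /\
    (forall y : nat -> bool, f x <= g x y).

Definition has_ylinear_quadratization (n m : nat) (f : (nat -> bool) -> R) : Prop :=
  exists (c : R) (b : nat -> R) (Q : nat -> nat -> R) (al : nat -> R)
         (be : nat -> nat -> R),
    is_quadratization n m f (ylin_poly n m c b Q al be).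

(* Main.v *)
(* Take n = 2^k - 1 and group the variables into blocks of sizes 1, 2, ...,
   2^(k-1).  Setting the blocks according to the binary digits of w realizes
   every weight w < 2^k, so f restricted to these points is an arbitrary real
   function of w.  Once the optimal values y_1(w), ..., y_m(w) of the auxiliary
   variables are fixed, a y-linear quadratization puts f in the span of at most
   (k + 1)(k + 1 + m) vectors of length 2^k: the products of a digit (or 1) with
   a digit, 1 or some y_i.  There are finitely many choices for the y_i, and
   f(x) = t^|x| with t generic avoids all the corresponding subspaces that are
   proper.  Hence 2^k <= (k + 1)(k + 1 + m). *)

Require Import Defs.
From Stdlib Require Import Reals Lra Lia.
From mathcomp Require all_boot all_algebra Rstruct.
Open Scope R_scope.

(* The 2^i consecutive coordinates j with 2^i <= j + 1 < 2^(i+1) all carry the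
   i-th binary digit of w. *)
Definition block_point (w j : nat) : bool := Nat.testbit w (Nat.log2 (S j)).

Lemma log2_block (k j : nat) : (j < 2 ^ k - 1)%nat -> (Nat.log2 (S j) < k)%nat.
Proof. intros jk; apply Nat.log2_lt_pow2; lia. Qed.

(** Coordinates from index [2 ^ k - 1] on lie in block [k], so each contributes digit [k] of [w].
    Partial blocks are allowed because [weight] adds one coordinate at a time. *)
Lemma weight_block (w k r : nat) : (r <= 2 ^ k)%nat ->
  (weight (2 ^ k - 1 + r) (block_point w) =
   weight (2 ^ k - 1) (block_point w) + r * Nat.b2n (Nat.testbit w k))%nat.
Proof.
induction r as [|r IHr]; intros rk.
- rewrite Nat.add_0_r; lia.
- assert (Hlog : Nat.log2 (S (2 ^ k - 1 + r)) = k).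
  { apply Nat.log2_unique; [lia|]; rewrite Nat.pow_succ_r'; lia. }
  rewrite Nat.add_succ_r; cbn [weight]; rewrite IHr by lia.
  unfold block_point at 2; rewrite Hlog.
  destruct (Nat.testbit w k); cbn [Nat.b2n]; lia.
Qed.

Lemma weight_block_point (w k : nat) :
  weight (2 ^ k - 1) (block_point w) = (w mod 2 ^ k)%nat.
Proof.
induction k as [|k IHk]; [now rewrite Nat.mod_1_r|].
pose proof (Nat.pow_nonzero 2 k ltac:(lia)).
replace (2 ^ S k - 1)%nat with (2 ^ k - 1 + 2 ^ k)%nat
  by (rewrite Nat.pow_succ_r'; lia).
rewrite weight_block, IHk, Nat.testbit_spec' by lia.
now rewrite Nat.pow_succ_r', (Nat.mul_comm 2), Nat.Div0.mod_mul_r.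
Qed.

Section GenericWeightFunction.

Import all_boot all_algebra Rstruct GRing.Theory Num.Theory.
Local Set Implicit Arguments.
Local Unset Strict Implicit.
Local Open Scope ring_scope.

Lemma row_lt_kernel (F : fieldType) (d N : nat) (A : 'M[F]_(d, N)) :
  (d < N)%N -> exists2 v : 'rV[F]_N, v != 0 &
    forall u : 'rV_N, (u <= A)%MS -> u *m v^T = 0.
Proof.
move=> dN; have: kermx A^T != 0.
  rewrite kermx_eq0 /row_free mxrank_tr neq_ltn.
  by rewrite (leq_ltn_trans (rank_leq_row A) dN).
case/rowV0Pn=> v /sub_kermxP vA v0; exists v => // u /submxP[D ->].
by rewrite -mulmxA -[A]trmxK -trmx_mul vA trmx0 mulmx0.
Qed.

(** The [size p] naturals below [size p] are distinct in characteristic zero, one more than the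
    degree allows as roots. *)
Lemma exists_nonroot (F : numFieldType) (p : {poly F}) :
  p != 0 -> exists t, ~~ root p t.
Proof.
move=> p0; pose s : seq F := [seq i%:R | i <- iota 0 (size p)].
case: (boolP (all (root p) s)) => [rs|/allPn[t _ nr]]; last by exists t.
have := max_poly_roots p0 rs; rewrite size_map size_iota ltnn.
by rewrite map_inj_uniq ?iota_uniq => [/(_ isT)//|i j /eqP]; rewrite eqr_nat => /eqP.
Qed.

(* The moment curve meets a proper subspace only at the roots of a nonzero
   polynomial. *)
Lemma moment_curve_avoids (F : numFieldType) (N : nat) (I : finType)
    (d : I -> nat) (A : forall i, 'M[F]_(d i, N)) :
  (forall i, d i < N)%N ->
  exists t : F, forall i, ~~ (\row_(w < N) t ^+ w <= A i)%MS.
Proof.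
move=> dN.
have /fin_all_exists[p pP] i : exists p : {poly F}, p != 0 /\
    forall t, (\row_(w < N) t ^+ w <= A i)%MS -> root p t.
  have [v v0 vA] := row_lt_kernel (A i) (dN i).
  (* Evaluating the polynomial with coefficient vector [v] at [t] is pairing [v] with the moment
     vector, which gives 0 on the row space of [A i]. *)
  exists (rVpoly v); split=> [|t /vA /matrixP/(_ ord0 ord0)].
    by apply: contra v0 => /eqP v0; rewrite -[v]rVpolyK v0 linear0.
  rewrite !mxE => v_t; apply/eqP; rewrite horner_poly -[RHS]v_t.
  by apply: eq_bigr => w _; rewrite valK !mxE mulrC.
have [|t] := @exists_nonroot F (\prod_i p i).
  by apply/prodf_neq0 => i _; have [] := pP i.
move=> nr; exists t => i; apply: contra nr => /((pP i).2 t) /eqP r0.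
by rewrite /root horner_prod (bigD1 i) //= r0 mul0r.
Qed.

Lemma mem_row_sub (F : fieldType) (N : nat) (s : seq 'rV[F]_N) (u : 'rV_N) :
  u \in s -> (u <= \matrix_(i < size s) s`_i)%MS.
Proof.
rewrite -index_mem => us; have := row_sub (Ordinal us) (\matrix_(i < size s) s`_i).
by rewrite rowK /= nth_index // -index_mem.
Qed.

(** The common factor [u] serves two cases: [u = 1] for plain sums, and [u] the values of an
    auxiliary variable multiplying a linear form. *)
Lemma row_sumR_sub (d N n : nat) (A : 'M[R]_(d, N)) (G : nat -> 'I_N -> R)
    (u : 'I_N -> R) :
  (forall j, (j < n)%N -> (\row_w (G j w * u w)%R <= A)%MS) ->
  (\row_w (sumR n (G^~ w) * u w)%R <= A)%MS.
Proof.
elim: n => [|n IHn] sG.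
  rewrite (_ : \row_w _ = 0) ?sub0mx //; apply/rowP => w.
  by rewrite !mxE /= mul0r.
rewrite (_ : \row_w _ = \row_w (sumR n (G^~ w) * u w) + \row_w (G n w * u w)).
  by apply: addmx_sub; [apply: IHn => j jn; apply: sG; exact: ltnW | exact: sG].
by apply/rowP => w; rewrite !mxE /= RplusE mulrDl.
Qed.

(** As a function of the sample index [w], each monomial is a scalar times a product of two 0/1
    vectors, and that product is their conjunction. Since no two auxiliary variables are multiplied,
    the first factor can always be taken from [C] (constant or [x]), and only [D] has to contain the
    [y i]. *)
Lemma ylin_poly_sub (d N n m : nat) (A : 'M[R]_(d, N)) (c : R) (b : nat -> R)
    (Q : nat -> nat -> R) (al : nat -> R) (be : nat -> nat -> R)
    (x y : 'I_N -> nat -> bool) (C D : pred {ffun 'I_N -> bool}) :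
  (forall a a', C a -> D a' -> (\row_w b2R (a w && a' w) <= A)%MS) ->
  C [ffun=> true] -> D [ffun=> true] ->
  (forall j, (j < n)%N -> C [ffun w => x w j]) ->
  (forall j, (j < n)%N -> D [ffun w => x w j]) ->
  (forall i, (i < m)%N -> D [ffun w => y w i]) ->
  (\row_w ylin_poly n m c b Q al be (x w) (y w) <= A)%MS.
Proof.
move=> CD C1 D1 Cx Dx Dy.
have term r a a' : C a -> D a' -> (\row_w (r * b2R (a w) * b2R (a' w))%R <= A)%MS.
  move=> Ca Da'; rewrite (_ : \row_w _ = r *: \row_w b2R (a w && a' w)).
    by apply: scalemx_sub; apply: CD.
  apply/rowP => w; rewrite !mxE.
  by case: (a w); case: (a' w); rewrite /= -!RmultE; lra.
have rowD (F G : 'I_N -> R) : (\row_w F w <= A)%MS -> (\row_w G w <= A)%MS ->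
    (\row_w (F w + G w)%R <= A)%MS.
  move=> sF sG; rewrite (_ : \row_w _ = \row_w F w + \row_w G w).
    exact: addmx_sub.
  by apply/rowP => w; rewrite !mxE.
have row_eq (F G : 'I_N -> R) : (\row_w F w <= A)%MS -> F =1 G -> (\row_w G w <= A)%MS.
  by move=> + FG; congr (_ <= A)%MS; apply/rowP => w; rewrite !mxE FG.
have sumD n' (G : nat -> 'I_N -> R) : (forall j, (j < n')%N -> (\row_w G j w <= A)%MS) ->
    (\row_w sumR n' (G^~ w) <= A)%MS.
  move=> sG; apply: (row_eq (fun w => sumR n' (G^~ w) * 1)) => [|w]; last exact: mulr1.
  apply: (row_sumR_sub (u := fun=> 1)) => j jn.
  by apply: (row_eq _ _ (sG j jn)) => w; rewrite mulr1.
rewrite /ylin_poly; apply: (rowD); first (apply: (rowD); first apply: (rowD)).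
- by apply: (row_eq _ _ (term c _ _ C1 D1)) => w; rewrite !ffunE /= !mulr1.
- apply: (sumD) => j jn.
  apply: (row_eq _ _ (term (b j) _ _ (Cx j jn) D1)) => w.
  by rewrite !ffunE /= mulr1.
- apply: (sumD) => j jn; apply: (sumD) => l ln.
  by apply: (row_eq _ _ (term (Q j l) _ _ (Cx j jn) (Dx l ln))) => w; rewrite !ffunE.
apply: (sumD) => i im.
apply: (row_eq (fun w => al i * b2R (y w i)
                + sumR n (fun j => be i j * b2R (x w j)) * b2R (y w i))) => [|w].
  apply: rowD.
    by apply: (row_eq _ _ (term (al i) _ _ C1 (Dy i im))) => w; rewrite !ffunE /= mulr1.
  apply: (row_sumR_sub (G := fun j w => be i j * b2R (x w j))
                       (u := fun w => b2R (y w i))) => j jn.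
  by apply: (row_eq _ _ (term (be i j) _ _ (Cx j jn) (Dy i im))) => w; rewrite !ffunE.
by rewrite RmultE RplusE mulrDl.
Qed.

Lemma exists_hard_symmetric (k : nat) :
  exists f : (nat -> bool) -> R, Defs.symmetric (Nat.pow 2 k - 1)%coq_nat f /\
    forall m, has_ylinear_quadratization (Nat.pow 2 k - 1)%coq_nat m f ->
      Peano.le (Nat.pow 2 k) (Nat.mul (S k) (S k + m)%coq_nat).
Proof.
set N := Nat.pow 2 k; set n := (N - 1)%coq_nat.
pose Zs : seq {ffun 'I_N -> bool} :=
  [ffun=> true] :: [seq [ffun w : 'I_N => Nat.testbit w i] | i <- iota 0 k].
pose chi (a a' : {ffun 'I_N -> bool}) : 'rV[R]_N := \row_w b2R (a w && a' w).
pose gens m (T : {ffun 'I_m -> {ffun 'I_N -> bool}}) : seq 'rV[R]_N :=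
  [seq chi a a' | a <- Zs, a' <- Zs ++ codom T].
have size_gens m T : size (@gens m T) = (k.+1 * (k.+1 + m))%N.
  by rewrite size_allpairs size_cat /= size_map size_iota size_codom card_ord.
(* A violating [m] is below [N], so the pairs of such an [m] and a table [T] of auxiliary values
   form a finite type. Hence one [t], fixed before any quadratization is given, works for all [m] at
   once. *)
pose small (m : 'I_N) := (k.+1 * (k.+1 + m) < N)%N.
pose I := {m : {m : 'I_N | small m} & {ffun 'I_(val m) -> {ffun 'I_N -> bool}}}.
have [|t t_avoids] := @moment_curve_avoids R N I
  (fun i => size (gens _ (tagged i)))
  (fun i => \matrix_(j < size (gens _ (tagged i))) (gens _ (tagged i))`_j).
  by case=> -[m sm] T; rewrite size_gens.
exists (fun x => t ^+ weight n x); split=> [x x' -> //|m].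
case=> c [b [Q [al [be quad]]]].
case: (leqP N (k.+1 * (k.+1 + m))) => [/leP //|sm]; exfalso.
have mN : (m < N)%N.
  by apply: leq_ltn_trans sm; rewrite mulSn -addnA addnCA leq_addr.
have /fin_all_exists[y yP] (w : 'I_N) := (quad (block_point w)).1.
pose T : {ffun 'I_m -> {ffun 'I_N -> bool}} := [ffun i : 'I_m => [ffun w => y w i]].
pose i : I := existT _ (exist _ (Ordinal mN) sm) T.
have /negP[] := t_avoids i.
have -> : \row_w t ^+ w = \row_w ylin_poly n m c b Q al be (block_point w) (y w).
  apply/rowP => w; rewrite !mxE yP weight_block_point Nat.mod_small //.
  exact/ltP.
have Zx j : (j < n)%N -> [ffun w : 'I_N => block_point w j] \in Zs.
  move=> /ltP/log2_block jk; rewrite inE; apply/orP; right.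
  by apply/mapP; exists (Nat.log2 j.+1) => //; rewrite mem_iota; apply/ltP.
apply: (@ylin_poly_sub _ _ _ _ _ _ _ _ _ _ _ _
         (fun a => a \in Zs) (fun a => a \in Zs ++ codom T)).
- by move=> a a' Za Ta; apply/mem_row_sub/allpairs_f.
- exact: mem_head.
- exact: mem_head.
- exact: Zx.
- by move=> j jn; rewrite mem_cat Zx.
move=> l lm; rewrite mem_cat; apply/orP; right.
by apply/codomP; exists (Ordinal lm); rewrite ffunE.
Qed.

End GenericWeightFunction.

(** From [2 ^ k - 1 >= 2 ^ (k - 1)] and [ln 2 > 1/2], the right side is at least [2 * (k - 1)]. *)
Lemma ln_pow2_minus_1_bound (k : nat) : (8 <= k)%nat ->
  INR (S k) <= 4 * ln (INR (2 ^ k - 1)).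
Proof.
intros k8.
assert (Hk : (2 ^ (k - 1) <= 2 ^ k - 1)%nat).
{ replace k with (S (k - 1)) at 2 by lia; rewrite Nat.pow_succ_r'.
  pose proof (Nat.pow_nonzero 2 (k - 1) ltac:(lia)); lia. }
apply le_INR in Hk; rewrite pow_INR in Hk; change (INR 2) with 2 in Hk.
assert (Hp : 0 < 2 ^ (k - 1)) by (apply pow_lt; lra).
assert (Hln : INR (k - 1) * ln 2 <= ln (INR (2 ^ k - 1))).
{ rewrite <- ln_pow by lra; destruct Hk as [Hk|<-]; [|lra].
  now apply Rlt_le, ln_increasing. }
pose proof ln_lt_2.
rewrite minus_INR in Hln by lia; rewrite S_INR.
apply le_INR in k8; simpl in k8; change (INR 1) with 1 in Hln; nra.
Qed.

Theorem theorem8 :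
  exists c : R, 0 < c /\
    forall N : nat, exists n : nat, (N <= n)%nat /\
      exists f : (nat -> bool) -> R, symmetric n f /\
        forall m : nat, has_ylinear_quadratization n m f ->
          c * INR n / ln (INR n) <= INR m.
Proof.
(* The 8 is 2 times 4: a factor 2 for absorbing [(k + 1)^2] into half of [2 ^ k], and a factor 4 for
   replacing [k + 1] by the logarithm. *)
exists (1 / 8); split; [lra|]; intros N.
(* The shift by 8 guarantees [2 * (k + 1)^2 <= 2 ^ k] and the logarithmic bound. *)
set (k := (N + 8)%nat).
exists (2 ^ k - 1)%nat; split.
- pose proof (Nat.pow_gt_lin_r 2 k ltac:(lia)); lia.
- destruct (exists_hard_symmetric k) as [f [Hsym Hf]].
  exists f; split; [exact Hsym|]; intros m Hm; specialize (Hf m Hm).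
  assert (Hsq : (2 * (S k * S k) <= 2 ^ k)%nat).
  { unfold k; clear; induction N as [|N IHN]; [vm_compute; lia|].
    rewrite Nat.add_succ_l, Nat.pow_succ_r'; nia. }
  assert (Hm' : (2 ^ k - 1 <= 2 * (S k * m))%nat) by nia.
  pose proof (ln_pow2_minus_1_bound k ltac:(lia)) as Hln.
  apply le_INR in Hm'; rewrite !mult_INR in Hm'; change (INR 2) with 2 in Hm'.
  pose proof (lt_0_INR (S k) ltac:(lia)); pose proof (pos_INR m).
  set (x := INR (2 ^ k - 1)) in *.
  assert (Hx : 0 < ln x) by lra.
  apply (Rmult_le_reg_r (ln x)); [exact Hx|].
  replace (1 / 8 * x / ln x * ln x) with (1 / 8 * x) by (field; lra).
  nra.
Qed.
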